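(* Let $(\pi,L,c)$ be a cyclic proof of a linear nested sequent $\mathcal{G}$, and suppose $\mathcal{G}=c(\mathcal{G}')$ for some cyclic leaf $\mathcal{G}'\in L$ (i.e. the root $\mathcal{G}$ of $\pi$ is the companion of the cyclic leaf $\mathcal{G}'$). Then there exists a cyclic proof of $\mathcal{G}'$ whose underlying derivation $\pi'$ is weakly isomorphic to $\pi$.
   Context: **Language.** Let $\mathsf{Atm}$ be a denumerable set of atoms. Formulae of $\mathscr{L}$ are given by $A,B ::= p \mid \bot \mid (A \to B) \mid \mathtt{X} A \mid (A \,\mathtt{U}\, B)$ with $p \in \mathsf{Atm}$. **Linear nested sequents.** A Gentzen sequent is $\Gamma\vdash\Delta$ with $\Gamma,\Delta$ finite sets of formulae. A linear nested sequent (LNS) is a nonempty finite sequence $\mathcal{G} = \Gamma_0\vdash\Delta_0 /\!/ \cdots /\!/ \Gamma_n\vdash\Delta_n$ of Gentzen sequents; $\Gamma_i\vdash\Delta_i$ is its $i$-component, $\Vert\mathcal{G}\Vert := n+1$ its length, and $\mathsf{end}(\mathcal{G}) := \Gamma_n\vdash\Delta_n$ its end component. **Rules** ($\mathsf{LNS_{LTL}}$). Here $\mathcal{G},\mathcal{H}$ are possibly empty, and the comma is set union (so in ''$\Gamma, A$'' one may have $A\in\Gamma$). Initial rules (no premises): $\mathsf{id}$: $\mathcal{G}/\!/\Gamma,p\vdash p,\Delta/\!/\mathcal{H}$; $\bot\mathsf{L}$: $\mathcal{G}/\!/\Gamma,\bot\vdash\Delta/\!/\mathcal{H}$. Their conclusions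 are called initial sequents. Logical rules: - ${\to}\mathsf{R}$: from $\mathcal{G}/\!/\Gamma,A\vdash B,\Delta/\!/\mathcal{H}$ infer $\mathcal{G}/\!/\Gamma\vdash A\to B,\Delta/\!/\mathcal{H}$. - ${\to}\mathsf{L}$: from $\mathcal{G}/\!/\Gamma,B\vdash\Delta/\!/\mathcal{H}$ and $\mathcal{G}/\!/\Gamma\vdash A,\Delta/\!/\mathcal{H}$ infer $\mathcal{G}/\!/\Gamma,A\to B\vdash\Delta/\!/\mathcal{H}$. - $\mathtt{X}\mathsf{L}_1$: from $\mathcal{G}/\!/\Gamma\vdash\Delta/\!/\Sigma,A\vdash\Pi/\!/\mathcal{H}$ infer $\mathcal{G}/\!/\Gamma,\mathtt{X}A\vdash\Delta/\!/\Sigma\vdash\Pi/\!/\mathcal{H}$. - $\mathtt{X}\mathsf{L}_2$: from $\mathcal{G}/\!/\Gamma\vdash\Delta/\!/A\vdash$ infer $\mathcal{G}/\!/\Gamma,\mathtt{X}A\vdash\Delta$. - $\mathtt{X}\mathsf{R}_1$: from $\mathcal{G}/\!/\Gamma\vdash\Delta/\!/\Sigma\vdash A,\Pi/\!/\mathcal{H}$ infer $\mathcal{G}/\!/\Gamma\vdash\mathtt{X}A,\Delta/\!/\Sigma\vdash\Pi/\!/\mathcal{H}$. - $\mathtt{X}\mathsf{R}_2$: from $\mathcal{G}/\!/\Gamma\vdash\Delta/\!/\vdash A$ infer $\mathcal{G}/\!/\Gamma\vdash\mathtt{X}A,\Delta$. - $\mathtt{U}\mathsf{L}_1$: from (left)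 $\mathcal{G}/\!/\Gamma,B\vdash\Delta/\!/\Sigma\vdash\Pi/\!/\mathcal{H}$ and (right) $\mathcal{G}/\!/\Gamma,A\vdash\Delta/\!/\Sigma,A\,\mathtt{U}\,B\vdash\Pi/\!/\mathcal{H}$ infer $\mathcal{G}/\!/\Gamma,A\,\mathtt{U}\,B\vdash\Delta/\!/\Sigma\vdash\Pi/\!/\mathcal{H}$. - $\mathtt{U}\mathsf{R}_1$: from (left) $\mathcal{G}/\!/\Gamma\vdash A,B,\Delta/\!/\Sigma\vdash\Pi/\!/\mathcal{H}$ and (right) $\mathcal{G}/\!/\Gamma\vdash B,\Delta/\!/\Sigma\vdash A\,\mathtt{U}\,B,\Pi/\!/\mathcal{H}$ infer $\mathcal{G}/\!/\Gamma\vdash A\,\mathtt{U}\,B,\Delta/\!/\Sigma\vdash\Pi/\!/\mathcal{H}$. - $\mathtt{U}\mathsf{L}_2$: from (left) $\mathcal{G}/\!/\Gamma,B\vdash\Delta$ and (right) $\mathcal{G}/\!/\Gamma,A\vdash\Delta/\!/A\,\mathtt{U}\,B\vdash$ infer $\mathcal{G}/\!/\Gamma,A\,\mathtt{U}\,B\vdash\Delta$. - $\mathtt{U}\mathsf{R}_2$: from (left) $\mathcal{G}/\!/\Gamma\vdash A,B,\Delta$ and (right) $\mathcal{G}/\!/\Gamma\vdash B,\Delta/\!/\vdash A\,\mathtt{U}\,B$ infer $\mathcal{G}/\!/\Gamma\vdash A\,\mathtt{U}\,B,\Delta$. **Derivations.** A derivation of $\mathcal{G}$ is a tree of LNSs with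 root $\mathcal{G}$ in which every parent node is the conclusion of a rule whose premises are its children (leaves need not be initial sequents). **Saturation.** An LNS $\mathcal{G}$ with components $\Gamma_0\vdash\Delta_0,\ldots,\Gamma_n\vdash\Delta_n$ is $i$-saturated ($0\le i\le n$) iff it is not an initial sequent and $\Gamma_i\cup\Delta_i$ contains no formula of the form $\mathtt{X}A$, $A\to B$ or $A\,\mathtt{U}\,B$. $\mathcal{G}$ is saturated iff it is $i$-saturated for each $0\le i<n$ (i.e., for every component other than the last). **Cyclic proofs.** A cyclic proof ($\mathsf{LNS^{cyc}_{LTL}}$-proof) of $\mathcal{G}$ is a tuple $(\pi,L,c)$ where (1) $\pi$ is a finite derivation of $\mathcal{G}$; (2) $L$ is a set of leaves of $\pi$ (cyclic leaves); (3) $c$ maps each leaf $\mathcal{F}\in L$ to a node $c(\mathcal{F})$ (its companion) lying on the path from the root to $\mathcal{F}$ and distinct from $\mathcal{F}$, such that $\Vert c(\mathcal{F})\Vert<\Vert\mathcal{F}\Vert$, the path from $c(\mathcal{F})$ to $\mathcal{F}$ goes through the right premise of a rule in $\{\mathtt{U}\mathsf{L}_1,\mathtt{U}\mathsf{L}_2\}$, both $c(\mathcal{F})$ and $\mathcal{F}$ are saturated, and $\mathsf{end}(c(\mathcal{F}))=\mathsf{end}(\mathcal{F})$; (4) every leaf of $\pi$ not in $L$ is an initial sequent. **Weak isomorphism.** A homomorphism from a derivation $\pi$ to a derivation $\pi'$ is a function $h$ mapping occurrences of LNSs in $\pi$ to occurrences of LNSs in $\pi'$ such that whenever a rule $\mathsf{r}$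 occurs in $\pi$ with premises $\mathcal{G}_1,\ldots,\mathcal{G}_n$ and conclusion $\mathcal{G}$, the same rule $\mathsf{r}$ occurs in $\pi'$ with premises $h(\mathcal{G}_1),\ldots,h(\mathcal{G}_n)$ and conclusion $h(\mathcal{G})$. $\pi$ and $\pi'$ are weakly isomorphic if there is a homomorphism $h:\pi\to\pi'$ whose inverse exists and is also a homomorphism. *)

(* Defs.v *)
From HB Require Import structures.
From mathcomp Require Import all_boot finmap.

Set Implicit Arguments.
Unset Strict Implicit.
Unset Printing Implicit Defensive.

Local Open Scope fset_scope.

Definition denumerable (T : Type) : Prop := exists f : nat -> T, bijective f.

Inductive form (Atm : Type) : Type :=
| Atom of Atm
| Bot
| Imp of form Atm & form Atm
| Next of form Atm
| Until of form Atm & form Atm.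

Arguments Bot {Atm}.

Fixpoint form_encode (Atm : Type) (A : form Atm) : GenTree.tree Atm :=
  match A with
  | Atom p => GenTree.Leaf p
  | Bot => GenTree.Node 0 [::]
  | Imp A B => GenTree.Node 1 [:: form_encode A; form_encode B]
  | Next A => GenTree.Node 2 [:: form_encode A]
  | Until A B => GenTree.Node 3 [:: form_encode A; form_encode B]
  end.

Fixpoint form_decode (Atm : Type) (t : GenTree.tree Atm) : option (form Atm) :=
  match t with
  | GenTree.Leaf p => Some (Atom p)
  | GenTree.Node 0 [::] => Some Bot
  | GenTree.Node 1 [:: t1; t2] =>
      if (form_decode t1, form_decode t2) is (Some A, Some B)
      then Some (Imp A B) else None
  | GenTree.Node 2 [:: t1] =>
      if form_decode t1 is Some A then Some (Next A) else None
  | GenTree.Node 3 [:: t1; t2] =>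
      if (form_decode t1, form_decode t2) is (Some A, Some B)
      then Some (Until A B) else None
  | _ => None
  end.

Lemma form_encodeK (Atm : Type) :
  pcancel (@form_encode Atm) (@form_decode Atm).
Proof. by elim=> //= [A -> B ->|A ->|A -> B ->]. Qed.

HB.instance Definition _ (Atm : countType) :=
  Countable.copy (form Atm) (pcan_type (@form_encodeK Atm)).

(* A Gentzen sequent "Gamma |- Delta" is the pair (Gamma, Delta). *)
Definition gsequent (Atm : countType) : Type :=
  ({fset form Atm} * {fset form Atm})%type.

Record lns (Atm : countType) : Type := LNS {
  components :> seq (gsequent Atm);
  components_gt0 : 0 < size components
}.

HB.instance Definition _ (Atm : countType) := [isSub for @components Atm].

Definition end_comp (Atm : countType) (G : lns Atm) : gsequent Atm :=
  last (fset0, fset0) G.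

Inductive rule : Type :=
| r_id | r_botL | r_impR | r_impL
| r_XL1 | r_XL2 | r_XR1 | r_XR2
| r_UL1 | r_UR1 | r_UL2 | r_UR2.

(* [rule_inst r prems concl]: the premises are listed from left to right.
   Since [A |` Gam] is a union, [A] may already belong to [Gam]. *)
Inductive rule_inst (Atm : countType) :
  rule -> seq (seq (gsequent Atm)) -> seq (gsequent Atm) -> Prop :=
| inst_id G H Gam Del p :
    rule_inst r_id [::] (G ++ (Atom p |` Gam, Atom p |` Del) :: H)
| inst_botL G H Gam Del :
    rule_inst r_botL [::] (G ++ (Bot |` Gam, Del) :: H)
| inst_impR G H Gam Del A B :
    rule_inst r_impR
      [:: G ++ (A |` Gam, B |` Del) :: H]
      (G ++ (Gam, Imp A B |` Del) :: H)
| inst_impL G H Gam Del A B :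
    rule_inst r_impL
      [:: G ++ (B |` Gam, Del) :: H; G ++ (Gam, A |` Del) :: H]
      (G ++ (Imp A B |` Gam, Del) :: H)
| inst_XL1 G H Gam Del Sig Pi A :
    rule_inst r_XL1
      [:: G ++ [:: (Gam, Del), (A |` Sig, Pi) & H]]
      (G ++ [:: (Next A |` Gam, Del), (Sig, Pi) & H])
| inst_XL2 G Gam Del A :
    rule_inst r_XL2
      [:: G ++ [:: (Gam, Del); ([fset A], fset0)]]
      (G ++ [:: (Next A |` Gam, Del)])
| inst_XR1 G H Gam Del Sig Pi A :
    rule_inst r_XR1
      [:: G ++ [:: (Gam, Del), (Sig, A |` Pi) & H]]
      (G ++ [:: (Gam, Next A |` Del), (Sig, Pi) & H])
| inst_XR2 G Gam Del A :
    rule_inst r_XR2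
      [:: G ++ [:: (Gam, Del); (fset0, [fset A])]]
      (G ++ [:: (Gam, Next A |` Del)])
| inst_UL1 G H Gam Del Sig Pi A B :
    rule_inst r_UL1
      [:: G ++ [:: (B |` Gam, Del), (Sig, Pi) & H];
          G ++ [:: (A |` Gam, Del), (Until A B |` Sig, Pi) & H]]
      (G ++ [:: (Until A B |` Gam, Del), (Sig, Pi) & H])
| inst_UR1 G H Gam Del Sig Pi A B :
    rule_inst r_UR1
      [:: G ++ [:: (Gam, A |` (B |` Del)), (Sig, Pi) & H];
          G ++ [:: (Gam, B |` Del), (Sig, Until A B |` Pi) & H]]
      (G ++ [:: (Gam, Until A B |` Del), (Sig, Pi) & H])
| inst_UL2 G Gam Del A B :
    rule_inst r_UL2
      [:: G ++ [:: (B |` Gam, Del)];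
          G ++ [:: (A |` Gam, Del); ([fset Until A B], fset0)]]
      (G ++ [:: (Until A B |` Gam, Del)])
| inst_UR2 G Gam Del A B :
    rule_inst r_UR2
      [:: G ++ [:: (Gam, A |` (B |` Del))];
          G ++ [:: (Gam, B |` Del); (fset0, [fset Until A B])]]
      (G ++ [:: (Gam, Until A B |` Del)]).

Definition initial (Atm : countType) (G : lns Atm) : Prop :=
  rule_inst r_id [::] G \/ rule_inst r_botL [::] G.

Definition decomposable (Atm : Type) (A : form Atm) : bool :=
  match A with
  | Next _ | Imp _ _ | Until _ _ => true
  | Atom _ | Bot => false
  end.

Definition i_saturated (Atm : countType) (G : lns Atm) (i : nat) : Prop :=
  ~ initial G /\
  forall A, A \in (nth (fset0, fset0) G i).1 `|` (nth (fset0, fset0) G i).2 ->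
    ~~ decomposable A.

(* All components but the last: vacuous when [G] has length 1. *)
Definition saturated (Atm : countType) (G : lns Atm) : Prop :=
  forall i, i < (size G).-1 -> i_saturated G i.

(* Finite trees of linear nested sequents; a parent node records the rule
   applied to obtain it from its children. *)
Inductive tree (Atm : countType) : Type :=
| Leaf of lns Atm
| Node of rule & lns Atm & seq (tree Atm).

Definition root_lns (Atm : countType) (t : tree Atm) : lns Atm :=
  match t with Leaf G => G | Node _ G _ => G end.

(* Occurrences in a tree are addressed by the list of child indices (from 0)
   read from the root; the root is [::]. *)
Definition pos : Type := seq nat.

Fixpoint subtree (Atm : countType) (t : tree Atm) (u : pos) {struct u} :
    option (tree Atm) :=
  match u, t with
  | [::], _ => Some t
  | _ :: _, Leaf _ => None
  | i :: u', Node _ _ ts => obind (fun s => subtree s u') (onth ts i)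
  end.

Definition lns_at (Atm : countType) (t : tree Atm) (u : pos) :
    option (lns Atm) :=
  omap (@root_lns Atm) (subtree t u).

Definition is_node (Atm : countType) (t : tree Atm) (u : pos) : Prop :=
  exists s, subtree t u = Some s.

Definition is_leaf (Atm : countType) (t : tree Atm) (u : pos) : Prop :=
  exists G, subtree t u = Some (Leaf G).

(* The condition [ts <> [::]] makes [Leaf] the only representation of leaves,
   including those that are conclusions of initial rules. *)
Definition derivation (Atm : countType) (t : tree Atm) : Prop :=
  forall u r G ts, subtree t u = Some (Node r G ts) ->
    ts <> [::] /\
    rule_inst r [seq components (root_lns s) | s <- ts] (components G).

(* The path from [u] up to [v] passes from the conclusion [w] of a UL1 or UL2
   inference to its right premise, which has index 1. *)
Definition through_right_UL (Atm : countType) (t : tree Atm) (u v : pos) :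
    Prop :=
  exists w r G ts,
    [/\ prefix u w, prefix (rcons w 1) v,
        subtree t w = Some (Node r G ts) & r = r_UL1 \/ r = r_UL2].

Record companion (Atm : countType) (t : tree Atm) (u v : pos) : Prop := {
  companion_path : prefix u v;
  companion_neq : u != v;
  companion_through : through_right_UL t u v;
  companion_lns : exists C F,
    [/\ lns_at t u = Some C, lns_at t v = Some F,
        size C < size F,
        saturated C /\ saturated F
      & end_comp C = end_comp F]
}.

(* The values of [c] outside [L] are irrelevant. *)
Record cyclic_proof (Atm : countType) (G : lns Atm) (t : tree Atm)
    (L : {fset pos}) (c : pos -> pos) : Prop := {
  cyclic_derivation : derivation t;
  cyclic_root : root_lns t = G;
  cyclic_leaf : forall v, v \in L -> is_leaf t v;
  cyclic_companion : forall v, v \in L -> companion t (c v) v;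
  cyclic_initial : forall v F,
    subtree t v = Some (Leaf F) -> v \notin L -> initial F
}.

(* [rule_occurs t r us u]: rule [r] occurs in [t] with premises at [us] and
   conclusion at [u]; at a leaf only rules without premises can occur. *)
Definition rule_occurs (Atm : countType) (t : tree Atm) (r : rule)
    (us : seq pos) (u : pos) : Prop :=
  match subtree t u with
  | Some (Leaf G) => us = [::] /\ rule_inst r [::] G
  | Some (Node r' _ ts) =>
      r = r' /\ us = [seq rcons u i | i <- iota 0 (size ts)]
  | None => False
  end.

(* The values of [h] outside the nodes of [t] are irrelevant. *)
Definition homomorphism (Atm : countType) (t t' : tree Atm) (h : pos -> pos) :
    Prop :=
  (forall u, is_node t u -> is_node t' (h u)) /\
  (forall r us u, rule_occurs t r us u -> rule_occurs t' r (map h us) (h u)).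

Definition weakly_isomorphic (Atm : countType) (t t' : tree Atm) : Prop :=
  exists h h' : pos -> pos,
    [/\ homomorphism t t' h, homomorphism t' t h',
        forall u, is_node t u -> h' (h u) = u
      & forall u, is_node t' u -> h (h' u) = u].

(* Main.v *)
(* Write the root as [Q // e] and the cyclic leaf as [P // e], with the same end
   component [e].  By saturation no rule, initial or logical, can act on a
   component of [Q] or of [P].  Hence every sequent of the derivation has the
   form [Q // K], and replacing [Q] by [P] throughout gives the required
   proof on the same tree, with the same cyclic leaves and companions. *)
Require Import Defs.
From mathcomp Require Import all_boot finmap.

Set Implicit Arguments.
Unset Strict Implicit.
Unset Printing Implicit Defensive.

Local Open Scope fset_scope.

(** * Inert components and the rules that can act beside them *)

Section Components.
Variable Atm : countType.
Implicit Types (x e : gsequent Atm) (P Q K S : seq (gsequent Atm)) (G : lns Atm).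

Definition closed_comp x : Prop :=
  Bot \in x.1 \/ exists2 p, Atom p \in x.1 & Atom p \in x.2.

(** Saturation read one component at a time, independently of the sequent around it. *)
Definition inert x : Prop :=
  ~ closed_comp x /\ forall A, A \in x.1 `|` x.2 -> ~~ decomposable A.

Definition all_inert S : Prop := forall x, x \in S -> inert x.

(** An initial rule inspects a single component. Conversely, the comma is a union, so a formula
    already in the component can be displayed as principal. *)
Lemma initialP G : initial G <-> exists2 x, x \in components G & closed_comp x.
Proof.
split=> [[]|[x /splitPr]].
- move E: r_id => r; move: E => /[swap]; case=> // G1 H Gam Del p _.
  exists (Atom p |` Gam, Atom p |` Del); first by rewrite mem_cat inE eqxx orbT.
  by right; exists p; rewrite /= fset1U1.
- move E: r_botL => r; move: E => /[swap]; case=> // G1 H Gam Del _.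
  exists (Bot |` Gam, Del); first by rewrite mem_cat inE eqxx orbT.
  by left; rewrite /= fset1U1.
- rewrite /initial; move: (components G) => _ [p1 p2] {G}.
  case: x => Gam Del [/= Gbot|[p /= Gp Dp]].
    by right; rewrite -[Gam](mem_fset1U Gbot); constructor.
  by left; rewrite -[Gam](mem_fset1U Gp) -[Del](mem_fset1U Dp); constructor.
Qed.

(** Not being initial concerns all components, so saturation constrains even the end, except in
    length 1, where it is vacuous. *)
Lemma saturated_rcons G S e : components G = rcons S e ->
  saturated G <-> all_inert S /\ (S <> [::] -> ~ closed_comp e).
Proof.
move=> defG; rewrite /saturated defG size_rcons /=; split=> [satG|[inS ncl]].
  split=> [x xS|S0 cl].
    have xG : x \in components G by rewrite defG mem_rcons inE xS orbT.
    have := satG (index x S); rewrite index_mem => /(_ xS) [nin nd].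
    split=> [cl|A]; first by apply/nin/initialP; exists x.
    by have := nd A; rewrite defG nth_rcons index_mem xS nth_index.
  case: S S0 defG satG => // y S _ defG /(_ 0 isT) [nin _].
  by apply/nin/initialP; exists e => //; rewrite defG mem_rcons inE eqxx.
move=> i ltiS; split=> [/initialP [x]|A].
  rewrite defG mem_rcons inE => /predU1P [->|/inS []] //.
  by apply: ncl; case: (S) ltiS.
rewrite defG nth_rcons ltiS.
by have [_] := inS _ (mem_nth (fset0, fset0) ltiS); apply.
Qed.

Lemma rule_inst_cat r Ks P K :
  rule_inst r Ks K -> rule_inst r [seq P ++ k | k <- Ks] (P ++ K).
Proof. by case=> *; rewrite /= !catA; constructor. Qed.

Lemma rule_inst_prem_neq0 r Ks K k : rule_inst r Ks K -> k \in Ks -> k <> [::].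
Proof.
by case=> [[|? ?]|[|? ?]|[|? ?]|[|? ?]|[|? ?]|[|? ?]|[|? ?]|[|? ?]|[|? ?]|[|? ?]
  |[|? ?]|[|? ?]] > //=; rewrite !inE => /= H E; rewrite E in H.
Qed.

(** In every rule the principal formula lies in the component right after the left context, and an
    inert component contains none. *)
Lemma rule_inst_inert_cons r ks x K :
    inert x -> rule_inst r ks (x :: K) ->
  exists2 Ks, ks = map (cons x) Ks & rule_inst r Ks K.
Proof.
move=> [ncl nd]; move E: (x :: K) => s inst; move: E; case: r ks s / inst.
all: move=> [|y G1] > /= [defx ->].
(* With an empty left context, [x] would carry the principal formula, against inertness. *)
all: try by case: ncl; rewrite defx; left; rewrite /= fset1U1.
all: try by case: ncl; rewrite defx; right; eexists; apply: fset1U1.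
all: try by move: nd; rewrite defx => /(_ _ (fsubsetP (fsubsetUl _ _) _ (fset1U1 _ _))).
all: try by move: nd; rewrite defx => /(_ _ (fsubsetP (fsubsetUr _ _) _ (fset1U1 _ _))).
all: rewrite -?defx.
(* Otherwise [x] heads the left context and can be removed throughout; the cases differ by the
   number of premises. *)
- by exists [::]; last constructor.
- by exists [::]; last constructor.
all: try (eexists [:: _]; first reflexivity; constructor).
all: eexists [:: _; _]; first reflexivity; constructor.
Qed.

Lemma rule_inst_inert r ks Q K :
    all_inert Q -> rule_inst r ks (Q ++ K) ->
  exists2 Ks, ks = [seq Q ++ k | k <- Ks] & rule_inst r Ks K.
Proof.
elim: Q ks => [|x Q IHQ] ks inQ inst; first by exists ks; rewrite ?map_id.
have [|ks' -> inst'] := rule_inst_inert_cons _ inst.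
  by apply: inQ; rewrite inE eqxx.
have [y yQ|Ks -> inst''] := IHQ _ _ inst'; first by apply: inQ; rewrite inE yQ orbT.
by exists Ks; rewrite -?map_comp.
Qed.

Lemma rule_inst0_inert r P Q K :
    all_inert Q -> rule_inst r [::] (Q ++ K) -> rule_inst r [::] (P ++ K).
Proof.
by move=> inQ /(rule_inst_inert inQ) [[|//] _ /(@rule_inst_cat _ _ P)].
Qed.

End Components.

(** * Relabelling trees, and prefixes kept along a derivation *)

Section MapTree.
Variable Atm : countType.
Implicit Types (t s : tree Atm) (u v : pos) (f : lns Atm -> lns Atm).

Fixpoint map_tree f t : tree Atm :=
  match t with
  | Leaf G => Leaf (f G)
  | Node r G ts => Node r (f G) (map (map_tree f) ts)
  end.

Lemma root_map_tree f t : root_lns (map_tree f t) = f (root_lns t).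
Proof. by case: t. Qed.

Lemma subtree_map_tree f t u :
  subtree (map_tree f t) u = omap (map_tree f) (subtree t u).
Proof.
elim: u t => [|i u IHu] [G|r G ts] //=.
by rewrite onth_map; case: (onth ts i) => //= s; apply: IHu.
Qed.

Lemma lns_at_map_tree f t u : lns_at (map_tree f t) u = omap f (lns_at t u).
Proof.
rewrite /lns_at subtree_map_tree; case: (subtree t u) => //= s.
by rewrite root_map_tree.
Qed.

Lemma derivation_child r G ts i s :
  derivation (Node r G ts) -> onth ts i = Some s -> derivation s.
Proof.
by move=> der tsi u r' G' ts' su; apply: (der (i :: u)); rewrite /= tsi.
Qed.

(** Read upwards, each rule acts inside [K] only. Keeping [K] nonempty ensures that the end
    component never belongs to [Q]. *)
Lemma derivation_prefix (Q : seq (gsequent Atm)) t :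
    all_inert Q -> derivation t ->
    (exists2 K, K <> [::] & components (root_lns t) = Q ++ K) ->
  forall u s, subtree t u = Some s ->
  exists2 K, K <> [::] & components (root_lns s) = Q ++ K.
Proof.
move=> inQ + + u; elim: u t => [|i u IHu] t der [K K0 defK] s.
  by case=> <-; exists K.
case: t der defK => //= r G ts der defK.
case tsi: (onth ts i) => [s'|//] /=.
apply: IHu; first exact: derivation_child der tsi.
have [_] := der [::] _ _ _ erefl.
rewrite defK => /(rule_inst_inert inQ) [Ks defKs inst].
have := congr1 (fun l => onth l i) defKs.
rewrite !onth_map tsi /=; case Ksi: (onth Ks i) => [k|//] /= [->].
exists k => //; apply: rule_inst_prem_neq0 inst _.
by apply/onthP; exists i.
Qed.

End MapTree.

(** * Exchanging the prefix [Q] for [P] in a whole cyclic proof *)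

Section Transplant.
Variables (Atm : countType) (P Q : seq (gsequent Atm)).
Hypotheses (P_gt0 : 0 < size P) (inP : all_inert P) (inQ : all_inert Q).

Lemma transplant_gt0 (G : lns Atm) : 0 < size (P ++ drop (size Q) G).
Proof. by rewrite size_cat addn_gt0 P_gt0. Qed.

(** Using [drop] makes the exchange total; it is meant for sequents that begin with [Q]. *)
Definition transplant (G : lns Atm) : lns Atm := LNS (transplant_gt0 G).

Lemma transplantE (G : lns Atm) K :
  components G = Q ++ K -> components (transplant G) = P ++ K.
Proof. by move=> /= ->; rewrite drop_size_cat. Qed.

Variable t : tree Atm.
Hypothesis der_t : derivation t.
Hypothesis root_t : exists2 K, K <> [::] & components (root_lns t) = Q ++ K.

Let t' := map_tree transplant t.

Lemma node_split u G : lns_at t u = Some G ->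
  exists K e, components G = Q ++ rcons K e.
Proof.
rewrite /lns_at; case tu: (subtree t u) => [s|//] [<-].
have [K + ->] := derivation_prefix inQ der_t root_t tu.
by case/lastP: K => // K e _; exists K, e.
Qed.

(** Neither [P] nor [Q] can host an initial rule, so the instance lies in the common remainder. This
    settles the leaves, which record no rule. *)
Lemma transplant_inst0 u r G : lns_at t u = Some G ->
  rule_inst r [::] (components G) <-> rule_inst r [::] (components (transplant G)).
Proof.
case/node_split=> K [e defG]; rewrite (transplantE defG) defG.
by split; apply: rule_inst0_inert.
Qed.

Lemma transplant_derivation : derivation t'.
Proof.
move=> u r G ts; rewrite subtree_map_tree.
case tu: (subtree t u) => [[//|r0 G0 ts0]|//] [<- <- <-].
have [ts0_neq0] := der_t tu.
have [|K [e defG]] := @node_split u G0; first by rewrite /lns_at tu.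
rewrite (transplantE defG) defG => /(rule_inst_inert inQ) [Ks defKs inst].
split; first by case: (ts0) ts0_neq0.
suff ->: [seq components (root_lns s) | s <- map (map_tree transplant) ts0]
          = [seq P ++ k | k <- Ks] by apply: rule_inst_cat.
(* Every premise has the form [Q ++ k], which the exchange sends to [P ++ k]. *)
transitivity [seq P ++ drop (size Q) k | k <- [seq components (root_lns s) | s <- ts0]].
  by rewrite -!map_comp; apply: eq_map => s /=; rewrite root_map_tree.
by rewrite defKs -map_comp; apply: eq_map => k /=; rewrite drop_size_cat.
Qed.

(** Both sequents begin with [Q], so their lengths shift equally and their ends stay; saturation
    survives because [P] is inert. *)
Lemma transplant_companion u v : companion t u v -> companion t' u v.
Proof.
case=> uv u_neq_v [w [r [G [ts [uw wv tw rUL]]]]] [C [F [tu tv ltCF [satC satF] eCF]]].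
split=> //.
  exists w, r, (transplant G), (map (map_tree transplant) ts).
  by rewrite subtree_map_tree tw.
have [[KC [eC defC]] [KF [eF defF]]] := (node_split tu, node_split tv).
move: (eCF); rewrite /end_comp defC defF -!rcons_cat !last_rcons => eE; subst eF.
have [inC _] : all_inert (Q ++ KC) /\ (Q ++ KC <> [::] -> ~ closed_comp eC).
  by apply: (saturated_rcons _).1 satC; rewrite defC rcons_cat.
have [inF nclF] : all_inert (Q ++ KF) /\ (Q ++ KF <> [::] -> ~ closed_comp eC).
  by apply: (saturated_rcons _).1 satF; rewrite defF rcons_cat.
(* The companion may have a single component, and then its saturation is void:
   that its end is not closed is known from the cyclic leaf only. *)
have {nclF} ncl : ~ closed_comp eC.
  apply: nclF => QKF0; move: ltCF.
  by rewrite defC defF -!rcons_cat !size_rcons QKF0.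
have satT (H : lns Atm) K :
    components H = Q ++ rcons K eC -> all_inert (Q ++ K) -> saturated (transplant H).
  move=> defH inH; apply/(saturated_rcons (S := P ++ K) (e := eC)).
    by rewrite (transplantE defH) rcons_cat.
  split=> // x; rewrite mem_cat => /orP [/inP //|xK].
  by apply: inH; rewrite mem_cat xK orbT.
exists (transplant C), (transplant F); rewrite !lns_at_map_tree tu tv; split=> //.
- move: ltCF; rewrite (transplantE defC) (transplantE defF) defC defF.
  by rewrite !size_cat !ltn_add2l.
- by split; [apply: satT defC inC | apply: satT defF inF].
- by rewrite /end_comp (transplantE defC) (transplantE defF) -!rcons_cat !last_rcons.
Qed.

Lemma transplant_rule_occurs r us u : rule_occurs t r us u <-> rule_occurs t' r us u.
Proof.
rewrite /rule_occurs subtree_map_tree.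
case tu: (subtree t u) => [[G|r0 G ts]|] //=; last by rewrite size_map.
have tuG : lns_at t u = Some G by rewrite /lns_at tu.
by have := transplant_inst0 r tuG; tauto.
Qed.

Lemma transplant_is_node u : is_node t u <-> is_node t' u.
Proof.
rewrite /is_node subtree_map_tree.
by case: (subtree t u) => [s|]; split=> -[s'] //=; eexists.
Qed.

(** The shape of the tree is unchanged, so the identity on addresses works in both directions. *)
Lemma transplant_isomorphic : weakly_isomorphic t' t.
Proof.
exists id, id; split=> //; split=> [u|r us u]; rewrite ?map_id.
- by move/transplant_is_node.
- by move/transplant_rule_occurs.
- by move/transplant_is_node.
- by move/transplant_rule_occurs.
Qed.

Lemma transplant_cyclic_proof G L c :
  cyclic_proof G t L c -> cyclic_proof (transplant G) t' L c.
Proof.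
case=> _ rootG leafL compL initL; split.
- exact: transplant_derivation.
- by rewrite root_map_tree rootG.
- move=> v /leafL [F tv]; exists (transplant F).
  by rewrite subtree_map_tree tv.
- by move=> v /compL /transplant_companion.
- move=> v F; rewrite subtree_map_tree.
  case tv: (subtree t v) => [[F0|//]|//] [<-] vL.
  have tvF : lns_at t v = Some F0 by rewrite /lns_at tv.
  case: (initL _ _ tv vL) => inst; [left|right]; exact/(transplant_inst0 _ tvF).
Qed.

End Transplant.

Theorem lemma5p6 (Atm : countType) (Atm_denum : denumerable Atm)
    (G : lns Atm) (t : tree Atm) (L : {fset pos}) (c : pos -> pos)
    (proof_t : cyclic_proof G t L c)
    (u : pos) (G' : lns Atm) (u_in_L : u \in L)
    (label_u : lns_at t u = Some G') (c_u : c u = [::]) :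
  exists (t' : tree Atm) (L' : {fset pos}) (c' : pos -> pos),
    cyclic_proof G' t' L' c' /\ weakly_isomorphic t' t.
Proof.
have [_ _ _ [C [F []]]] := cyclic_companion proof_t u_in_L.
rewrite c_u label_u => -[rootC] [<-] {F} ltCG' [satC satG'].
rewrite (cyclic_root proof_t) in rootC; subst C.
case/lastP defG: (components G) (components_gt0 G) => [//|Q e] _.
case/lastP defG': (components G') (components_gt0 G') => [//|P e'] _.
rewrite /end_comp defG defG' !last_rcons => eE; subst e'.
move: ltCG'; rewrite defG defG' !size_rcons ltnS => ltQP.
(* The leaf is strictly longer than its companion, so its prefix is nonempty even when [Q] is
   empty. *)
have P_gt0 : 0 < size P by apply: leq_ltn_trans ltQP.
have [inQ _] := (saturated_rcons defG).1 satC.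
have [inP _] := (saturated_rcons defG').1 satG'.
have root_t : exists2 K, K <> [::] & components (root_lns t) = Q ++ K.
  by exists [:: e]; rewrite // (cyclic_root proof_t) defG cats1.
have der_t := cyclic_derivation proof_t.
(* Here the equality of the two end components is used: the root, with its prefix exchanged, is the
   cyclic leaf. *)
have defT : transplant Q P_gt0 G = G'.
  by apply: val_inj; rewrite /= defG defG' -!cats1 drop_size_cat.
exists (map_tree (transplant Q P_gt0) t), L, c; split.
  by rewrite -defT; apply: transplant_cyclic_proof.
exact: transplant_isomorphic.
Qed.
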